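(* Let $m\in\mathbb N$ and let $f:\mathbb R\to\mathbb T\mathbb P^m$ be a $1$-st tropical holomorphic curve with a reduced representation $\mathbf f=(f_0,\dots,f_m)$. Let $\mathcal P(x)=\sum_{i=0}^m\alpha_ix_i^n$ (ordinary sum and powers), where $n\in\mathbb N$ and $\alpha_i>0$ for $i=0,\dots,m$. If $$\limsup_{r\to+\infty}\frac{r}{T_f(r)}=0,$$ then $$\theta\,T_f^n(r)\le\sum_{j=1}^nN^{(j)}\left(r,1_0\oslash(\mathcal P\circ f)\right)+o(T_f^n(r))\le\Theta\,T_f^n(r)$$ as $r$ tends to infinity, where $\theta=\min_{0\le i\le m}\alpha_i$ and $\Theta=2^{n-1}\sum_{i=0}^m\alpha_i$.
   Context: $\mathbb N=\{1,2,\dots\}$. $a\oslash b=a-b$ and $1_0=0$, so $1_0\oslash g=-g$. $T_f^n(r)=(T_f(r))^n$. For $n\in\mathbb N$, an $n$-th tropical meromorphic function is a continuous function $g:\mathbb R\to\mathbb R$ for which there is an increasing sequence of breakpoints without finite accumulation point such that $g$ is a polynomial on each segment, the supremum of the degrees being $n$; a $0$-th one is a constant. Sign convention: $\operatorname{sgn}(x^{\pm})=\operatorname{sgn}(x)$ for $x\ne0$ and $\operatorname{sgn}(0^{\pm})=\pm1$. $\omega_g^{(j)}(x)=\frac1{j!}\left(\operatorname{sgn}^{j+1}(x^+)g^{(j)}(x^+)-\operatorname{sgn}^{j+1}(x^-)g^{(j)}(x^-)\right)$, with one-sided derivatives. $x$ is a $j$-th root (pole) of $g$ if $\omega_g^{(j)}(x)>0$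 ($<0$), with multiplicity $|\omega_g^{(j)}(x)|$. $g$ is tropical entire if it has no $j$-th poles for any $j$ (so $1$-st tropical entire functions are the non-constant convex piecewise linear functions with breakpoints not accumulating at a finite point). $N^{(j)}(r,g)=\frac12\sum_z|\omega_g^{(j)}(z)|(r-|z|)^j$, over all $j$-th poles $z$ of $g$ in $(-r,r)$. $\mathbb T\mathbb P^m$ is the quotient of $(\mathbb R\cup\{-\infty\})^{m+1}\setminus\{(-\infty,\dots,-\infty)\}$ by $(a_0,\dots,a_m)\sim(a_0+\lambda,\dots,a_m+\lambda)$, $\lambda\in\mathbb R$. A $1$-st tropical holomorphic curve is a map $f=[f_0:\cdots:f_m]:\mathbb R\to\mathbb T\mathbb P^m$ where each $f_i$ is a $1$-st tropical entire function or a constant, not all constant. The tuple $\mathbf f=(f_0,\dots,f_m)$ is a reduced representation if no point is a root common to all of $f_0,\dots,f_m$. The tropical Cartan characteristic function is $T_f(r)=\frac12(F(r)+F(-r))-F(0)$ with $F=\max_{0\le i\le m}f_i$ (for a reduced representation). $\mathcal P\circ f=\sum_{i=0}^m\alpha_if_i^n$ (ordinary powers). *)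

(* Defs.v *)
From HB Require Import structures.
From mathcomp Require Import all_boot all_order all_algebra.
From mathcomp Require Import all_classical all_reals all_analysis.
From mathcomp Require Import generic_quotient.

Set Implicit Arguments.
Unset Strict Implicit.
Unset Printing Implicit Defensive.

Import Order.TTheory GRing.Theory Num.Theory.
Import numFieldNormedType.Exports.

Local Open Scope classical_set_scope.
Local Open Scope ring_scope.
Local Open Scope quotient_scope.

Definition trop_one (R : realType) : R := 0.
Definition trop_div (R : realType) (a b : R) : R := a - b.

(* The breakpoint sequence is indexed by all of int: a finite or one-sided
   sequence is represented by adding spurious breakpoints, across which the two
   adjacent polynomials agree; this changes neither [g] nor the degrees.
   The degree of the zero polynomial counts as 0, so the supremum of the
   degrees is a natural number, hence attained. *)
Definition trop_mero (R : realType) (n : nat) (g : R -> R) : Prop :=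
  continuous g /\
  exists (b : int -> R) (p : int -> {poly R}),
    [/\ {homo b : k l / k < l},
        limit_point (range b) = set0,
        forall (k : int) (x : R), b k <= x <= b (k + 1) -> g x = (p k).[x],
        forall k : int, ((size (p k)).-1 <= n)%N &
        exists k : int, (size (p k)).-1 = n].

Definition sgr_right (R : realType) (x : R) : R :=
  if x == 0 then 1 else Num.sg x.
Definition sgr_left (R : realType) (x : R) : R :=
  if x == 0 then -1 else Num.sg x.

(* [g^(j)(x^+)] and [g^(j)(x^-)] are the one-sided limits of the j-th
   derivative; for piecewise polynomial [g] they are the iterated one-sided
   derivatives. *)
Definition derive_right (R : realType) (j : nat) (g : R -> R) (x : R) : R :=
  lim ((g^`(j))%classic y @[y --> x^'+]).
Definition derive_left (R : realType) (j : nat) (g : R -> R) (x : R) : R :=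
  lim ((g^`(j))%classic y @[y --> x^'-]).

Definition omega (R : realType) (j : nat) (g : R -> R) (x : R) : R :=
  (j`!%:R)^-1 * (sgr_right x ^+ j.+1 * derive_right j g x
                 - sgr_left x ^+ j.+1 * derive_left j g x).

Definition jroot (R : realType) (j : nat) (g : R -> R) (x : R) : Prop :=
  0 < omega j g x.
Definition jpole (R : realType) (j : nat) (g : R -> R) (x : R) : Prop :=
  omega j g x < 0.

Definition trop_root (R : realType) (g : R -> R) (x : R) : Prop :=
  exists2 j : nat, (0 < j)%N & jroot j g x.

Definition trop_entire (R : realType) (n : nat) (g : R -> R) : Prop :=
  trop_mero n g /\ forall (j : nat) (x : R), (0 < j)%N -> ~ jpole j g x.

Definition constant_fun (R : realType) (g : R -> R) : Prop :=
  exists c : R, forall x : R, g x = c.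

(* [\sum_(z \in A)] is the finitely supported sum; a piecewise polynomial
   function has only finitely many j-th poles in a bounded interval. *)
Definition trop_N (R : realType) (j : nat) (r : R) (g : R -> R) : R :=
  2^-1 * \sum_(z \in [set z : R | - r < z < r /\ jpole j g z])
           (`|omega j g z| * (r - `|z|) ^+ j).

Definition tp_coord (R : realType) (m : nat) : pred {ffun 'I_m.+1 -> \bar R} :=
  fun a => [forall i, a i != +oo%E] && [exists i, a i != -oo%E].

Definition tp_vec (R : realType) (m : nat) := {a | @tp_coord R m a}.

Definition tp_rel (R : realType) (m : nat) : rel (tp_vec R m) :=
  fun a b => `[< exists lam : R, forall i, val b i = (val a i + lam%:E)%E >].

Lemma tp_rel_refl (R : realType) (m : nat) : reflexive (@tp_rel R m).
Proof. by move=> a; apply/asboolP; exists 0 => i; rewrite adde0. Qed.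

Lemma tp_rel_sym (R : realType) (m : nat) : symmetric (@tp_rel R m).
Proof.
have H a b : @tp_rel R m a b -> tp_rel b a.
  move=> /asboolP[l Hl]; apply/asboolP; exists (- l) => i.
  by rewrite Hl -addeA -EFinD subrr adde0.
by move=> a b; apply/idP/idP; exact: H.
Qed.

Lemma tp_rel_trans (R : realType) (m : nat) : transitive (@tp_rel R m).
Proof.
move=> b a c /asboolP[l Hl] /asboolP[l' Hl']; apply/asboolP; exists (l + l') => i.
by rewrite Hl' Hl EFinD addeA.
Qed.

Definition tp_equiv (R : realType) (m : nat) : equiv_rel (tp_vec R m) :=
  EquivRel (@tp_rel R m) (@tp_rel_refl R m) (@tp_rel_sym R m)
    (@tp_rel_trans R m).

Definition TP (R : realType) (m : nat) := {eq_quot (tp_equiv R m)}.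

Lemma tp_coord_EFin (R : realType) (m : nat) (a : 'I_m.+1 -> R) :
  tp_coord [ffun i => (a i)%:E].
Proof.
apply/andP; split; first by apply/forallP => i; rewrite ffunE.
by apply/existsP; exists ord0; rewrite ffunE.
Qed.

(* The point [a_0 : ... : a_m] with finite homogeneous coordinates. *)
Definition tp_point (R : realType) (m : nat) (a : 'I_m.+1 -> R) : TP R m :=
  \pi_(TP R m) (exist (fun v => is_true (tp_coord v)) _ (tp_coord_EFin a)).

Definition representation (R : realType) (m : nat) (f : R -> TP R m)
    (ff : 'I_m.+1 -> R -> R) : Prop :=
  [/\ forall i, trop_entire 1 (ff i) \/ constant_fun (ff i),
      ~ (forall i, constant_fun (ff i)) &
      forall x : R, f x = tp_point (fun i => ff i x)].

Definition trop_hol_curve (R : realType) (m : nat) (f : R -> TP R m) : Prop :=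
  exists ff : 'I_m.+1 -> R -> R, representation f ff.

Definition reduced_representation (R : realType) (m : nat) (f : R -> TP R m)
    (ff : 'I_m.+1 -> R -> R) : Prop :=
  representation f ff /\ ~ exists x : R, forall i, trop_root (ff i) x.

Definition cartan_F (R : realType) (m : nat) (ff : 'I_m.+1 -> R -> R)
    (x : R) : R :=
  \big[Num.max/ff ord0 x]_(i < m.+1) ff i x.

(* Computed from a reduced representation [ff] of the curve; it does not depend
   on the choice of that representation. *)
Definition cartan_T (R : realType) (m : nat) (ff : 'I_m.+1 -> R -> R)
    (r : R) : R :=
  2^-1 * (cartan_F ff r + cartan_F ff (- r)) - cartan_F ff 0.

Definition fermat_poly (R : realType) (m n : nat) (alpha x : 'I_m.+1 -> R) : R :=
  \sum_(i < m.+1) alpha i * x i ^+ n.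

Definition fermat_comp (R : realType) (m n : nat) (alpha : 'I_m.+1 -> R)
    (ff : 'I_m.+1 -> R -> R) : R -> R :=
  fun x => fermat_poly n alpha (fun i => ff i x).

(* Required by the Landau notation [=o_ (pinfty_nbhs R)]. *)
Lemma pinfty_nbhs_isfilter (R : realType) : Filter (pinfty_nbhs R).
Proof. exact: filter_filter. Qed.

Canonical pinfty_filter_on (R : realType) :=
  FilterType (pinfty_nbhs R) (pinfty_nbhs_isfilter R).

(* Main.v *)
Require Import Defs.
From HB Require Import structures.
From mathcomp Require Import all_boot all_order all_algebra.
From mathcomp Require Import all_classical all_reals all_analysis.
From mathcomp Require Import finmap ring lra.
Import Order.TTheory GRing.Theory Num.Theory.
Import numFieldNormedType.Exports.
Local Open Scope classical_set_scope.
Local Open Scope ring_scope.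

Set Implicit Arguments.
Unset Strict Implicit.
Unset Printing Implicit Defensive.

(* A convex piecewise linear [g] satisfies the tropical Jensen formula for
   [g ^+ n]: the binomial theorem turns the sum over [j] of the weighted [j]-th
   jumps at [z > 0] into the difference of the two lines meeting at [z],
   evaluated at [r] and raised to the power [n], and these differences telescope
   along the breakpoints.  Summing over the components, the poles minus the roots
   of [- P o f] count exactly the symmetric mean of [P o f] minus its value at
   [0].  The roots only contribute [O(r ^+ n)]: a breakpoint [z > 0] of [f_i]
   contributes negatively only where [f_i] or its slope is negative, and there
   the slopes are bounded and their increments telescope.  Each [f_i] is bounded
   below by [- C r], so the mean of [P o f] is squeezed between
   [theta (T_f - O(r)) ^+ n] and [Theta (T_f + O(r)) ^+ n] up to [O(r ^+ n)] by
   [((a + b) / 2) ^+ n <= (a ^+ n + b ^+ n) / 2 <= (a + b) ^+ n / 2], and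
   [r = o(T_f)] absorbs all the errors. *)

(** * One-sided derivatives of sums of powers of affine functions *)

Lemma derive1n_horner_itv (R : realType) (g : R -> R) (p : {poly R}) (a b : R) :
  (forall x, a < x < b -> g x = p.[x]) ->
  forall (j : nat) (x : R), a < x < b -> (g^`(j))%classic x = (p^`(j)).[x].
Proof.
move=> gp; elim=> [|j IHj] x xab; first by rewrite derive1n0 derivn0 gp.
rewrite derive1nS derivnS derivE !derive1E; apply: near_eq_derive.
have xI : x \in `]a, b[ by rewrite in_itv.
by apply: filterS (near_in_itvoo xI) => y; rewrite in_itv /= => /IHj.
Qed.

Lemma derive_right_horner (R : realType) (g : R -> R) (p : {poly R}) (x b : R)
    (j : nat) :
  x < b -> (forall y, x < y < b -> g y = p.[y]) ->
  derive_right j g x = (p^`(j)).[x].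
Proof.
move=> xb gp; apply/cvg_lim => //.
have : (p^`(j)).[y] @[y --> x^'+] --> (p^`(j)).[x].
  by apply: cvg_at_right_filter; exact: continuous_horner.
apply: cvg_trans; apply: near_eq_cvg.
apply: filterS2 (nbhs_right_gt x) (nbhs_right_lt xb) => y xy yb /=.
by apply/esym; apply: derive1n_horner_itv gp _ _ _; rewrite xy.
Qed.

Lemma derive_left_horner (R : realType) (g : R -> R) (p : {poly R}) (a x : R)
    (j : nat) :
  a < x -> (forall y, a < y < x -> g y = p.[y]) ->
  derive_left j g x = (p^`(j)).[x].
Proof.
move=> ax gp; apply/cvg_lim => //.
have : (p^`(j)).[y] @[y --> x^'-] --> (p^`(j)).[x].
  by apply: cvg_at_left_filter; exact: continuous_horner.
apply: cvg_trans; apply: near_eq_cvg.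
apply: filterS2 (nbhs_left_gt ax) (nbhs_left_lt x) => y ay yx /=.
by apply/esym; apply: derive1n_horner_itv gp _ _ _; rewrite ay.
Qed.

Lemma derivn_affine_exp (R : comNzRingType) (c s : R) (n j : nat) :
  ((c%:P + s *: 'X) ^+ n)^`(j)
  = ((n ^_ j)%:R * s ^+ j) *: (c%:P + s *: 'X) ^+ (n - j).
Proof.
elim: j => [|j IHj]; first by rewrite derivn0 ffactn0 expr0 mulr1 scale1r subn0.
rewrite derivnS IHj derivZ deriv_exp derivD derivC derivZ derivX add0r.
rewrite -subnS ffactnSr natrM exprS -scalerAl mul1r.
by rewrite -[X in _ *: X]scaler_nat !scalerA; congr (_ *: _); ring.
Qed.

Section SumOfAffinePowers.
Variables (R : realType) (m n : nat) (alpha c s : 'I_m -> R).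

Let sum_poly (x : R) : {poly R} :=
  \sum_(i < m) alpha i *: ((c i - s i * x)%:P + s i *: 'X) ^+ n.

Let horner_sum_poly (x y : R) :
  (sum_poly x).[y] = \sum_(i < m) alpha i * (c i + s i * (y - x)) ^+ n.
Proof.
rewrite horner_sum; apply: eq_bigr => i _; rewrite !hornerE /=.
by congr (_ * _ ^+ _); ring.
Qed.

Let derivn_sum_poly (x : R) (j : nat) :
  ((sum_poly x)^`(j)).[x]
  = \sum_(i < m) alpha i * ((n ^_ j)%:R * (c i ^+ (n - j) * s i ^+ j)).
Proof.
rewrite linear_sum horner_sum; apply: eq_bigr => i _ /=.
rewrite derivnZ derivn_affine_exp !hornerE /=.
have -> : c i - s i * x + s i * x = c i by ring.
by ring.
Qed.

Lemma derive_right_sum_affine_exp (g : R -> R) (x b : R) (j : nat) :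
  x < b ->
  (forall y, x < y < b ->
     g y = \sum_(i < m) alpha i * (c i + s i * (y - x)) ^+ n) ->
  derive_right j g x
  = \sum_(i < m) alpha i * ((n ^_ j)%:R * (c i ^+ (n - j) * s i ^+ j)).
Proof.
move=> xb gE; rewrite -(derivn_sum_poly x); apply: derive_right_horner xb _ => y yxb.
by rewrite horner_sum_poly gE.
Qed.

Lemma derive_left_sum_affine_exp (g : R -> R) (a x : R) (j : nat) :
  a < x ->
  (forall y, a < y < x ->
     g y = \sum_(i < m) alpha i * (c i + s i * (y - x)) ^+ n) ->
  derive_left j g x
  = \sum_(i < m) alpha i * ((n ^_ j)%:R * (c i ^+ (n - j) * s i ^+ j)).
Proof.
move=> ax gE; rewrite -(derivn_sum_poly x); apply: derive_left_horner ax _ => y yxb.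
by rewrite horner_sum_poly gE.
Qed.

End SumOfAffinePowers.

(** * Convex piecewise linear functions *)

(** [x ^+ n - y ^+ n] is [x - y] times a sum of [n] monomials, each bounded by [M ^+ n.-1]. *)
Lemma ler_norm_subX (R : realDomainType) (M x y : R) (n : nat) :
  `|x| <= M -> `|y| <= M -> `|x ^+ n - y ^+ n| <= n%:R * M ^+ n.-1 * `|x - y|.
Proof.
move=> xM yM; have M0 : 0 <= M := le_trans (normr_ge0 x) xM.
rewrite subrXX normrM mulrC ler_wpM2r//.
apply: (le_trans (ler_norm_sum _ _ _)).
rewrite mulr_natl -[X in _ *+ X]card_ord -sumr_const; apply: ler_sum => i _.
rewrite normrM !normrX.
have -> : M ^+ n.-1 = M ^+ (n.-1 - i) * M ^+ i.
  by rewrite -exprD subnK// -ltnS prednK// (leq_ltn_trans _ (ltn_ord i)).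
by rewrite ler_pM ?exprn_ge0// lerXn2r ?nnegrE.
Qed.

Lemma sum_binomial_tail (R : comNzRingType) (n : nat) (c s h : R) :
  \sum_(1 <= j < n.+1) 'C(n, j)%:R * (c ^+ (n - j) * s ^+ j) * h ^+ j
  = (c + s * h) ^+ n - c ^+ n.
Proof.
rewrite exprDn -(big_mkord xpredT
  (fun j => c ^+ (n - j) * (s * h) ^+ j *+ 'C(n, j))) big_nat_recl//.
rewrite subn0 expr0 mulr1 bin0 mulr1n addrC addKr big_add1 /=.
by apply: eq_bigr => j _; rewrite exprMn -mulr_natl; ring.
Qed.

Lemma sum_itv_split (R : realDomainType) (V : nmodType) (s : seq R) (x z y : R)
    (X : R -> V) :
  uniq s -> z \in s -> x < z < y ->
  \sum_(w <- s | x < w < y) X w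
  = \sum_(w <- s | x < w < z) X w + X z + \sum_(w <- s | z < w < y) X w.
Proof.
move=> us zs /andP[xz zy].
have -> : X z = \sum_(w <- s | w == z) X w.
  rewrite big_mkcond (bigD1_seq z)//= eqxx big1 ?addr0// => w.
  by case: eqP.
rewrite big_mkcond [in RHS]big_mkcond [X in _ + X + _]big_mkcond.
rewrite [X in _ + X]big_mkcond -!big_split; apply: eq_bigr => w _ /=.
have [wz|zw|wz] := ltgtP w z.
- by rewrite (lt_trans wz zy) !andbT !addr0.
- by rewrite (lt_trans xz zw) !andbF !add0r.
- by rewrite wz xz zy !andbF add0r addr0.
Qed.

(** The end points need not lie in [B], so a subinterval of a gap is again a gap. *)
Definition gap (R : realType) (B : set R) (x y : R) : Prop :=
  x < y /\ forall z, x < z < y -> ~ B z.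

(** Induction along the sorted finite list of points of [B] inside []x, y[], splitting at the
    smallest one. *)
Lemma gap_ind (R : realType) (B : set R) (Q : R -> R -> Prop) :
  (forall x y, finite_set (B `&` [set z | x < z < y])) ->
  (forall x y, gap B x y -> Q x y) ->
  (forall x z y, B z -> x < z < y -> Q x z -> Q z y -> Q x y) ->
  forall x y, x < y -> Q x y.
Proof.
move=> Bfin Qgap Qtrans x y.
pose s := sort <=%R (fset_set (B `&` [set z | x < z < y])).
have : path <%R x s.
  rewrite path_min_sorted ?sort_lt_sorted ?fset_uniq//.
  by apply/allP => z; rewrite mem_sort in_fset_set// => /set_mem[_ /andP[]].
have : forall z, (z \in s) <-> (B z /\ x < z < y).
  move=> z; rewrite mem_sort in_fset_set//; split; first by move/set_mem.
  by move=> Bz; apply/mem_set.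
move: s => s; elim: s x => [|z s IHs] x sB /= sx xy.
  by apply: Qgap; split=> // z xzy Bz; have /sB : B z /\ x < z < y by [].
have /sB[Bz /andP[xz zy]] : z \in z :: s by rewrite mem_head.
have /andP[_ zs] := sx.
apply: (Qtrans _ z) => //; first by rewrite xz.
  apply: Qgap; split=> // w /andP[xw wz] Bw.
  have /sB : B w /\ x < w < y by rewrite xw (lt_trans wz zy).
  rewrite inE => /orP[/eqP wE|]; first by rewrite wE ltxx in wz.
  move: zs; rewrite lt_path_sortedE => /andP[/allP zs _] /zs.
  by rewrite ltNge (ltW wz).
apply: IHs => // w; split=> [ws|[Bw /andP[zw wy]]].
  have /sB[Bw /andP[_ wy]] : w \in z :: s by rewrite inE ws orbT.
  split=> //; rewrite wy andbT.
  by move: zs; rewrite lt_path_sortedE => /andP[/allP/(_ _ ws)].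
have /sB : B w /\ x < w < y by rewrite wy (lt_trans xz zw).
by rewrite inE => /orP[/eqP wE|//]; rewrite wE ltxx in zw.
Qed.

(** Between consecutive points of [B] the outgoing value [A] equals the next incoming value [C], so
    only the two ends survive. Points of [s] outside [B] are harmless: there [A] and [C] agree. *)
Lemma telescope_gap (R : realType) (B : set R) (A C : R -> R)
    (s : seq R) (x y : R) :
  (forall x y, finite_set (B `&` [set z | x < z < y])) ->
  (forall x y, gap B x y -> C y = A x) ->
  uniq s -> (forall z, B z -> x < z < y -> z \in s) -> x < y ->
  \sum_(z <- s | x < z < y) (A z - C z) = C y - A x.
Proof.
move=> Bfin AC us sB xy; move: x y xy sB.
apply: (gap_ind (B := B)) => // [x y gxy _|x z y Bz xzy Qxz Qzy sB].
  rewrite (AC _ _ gxy) subrr big1// => z /andP[xz zy].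
  have gxz : gap B x z.
    split=> // w /andP[xw wz]; apply: gxy.2; rewrite xw.
    exact: lt_trans wz zy.
  have gzy : gap B z y.
    split=> // w /andP[zw wy]; apply: gxy.2; rewrite wy andbT.
    exact: lt_trans xz zw.
  by rewrite -(AC _ _ gzy) (AC _ _ gxy) (AC _ _ gxz) subrr.
have /andP[xz zy] := xzy.
rewrite (sum_itv_split _ us (sB _ Bz xzy) xzy) Qxz ?Qzy.
- by ring.
- by move=> w Bw /andP[zw wy]; apply: sB => //; rewrite wy (lt_trans xz).
- by move=> w Bw /andP[xw wz]; apply: sB => //; rewrite xw (lt_trans wz).
Qed.

(** [sp] and [sm] are the right and left slopes. [B] may contain more than the breakpoints, so that
    several functions can share it. *)
Record convex_pl (R : realType) (g sp sm : R -> R) (B : set R) : Prop :=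
  ConvexPL {
  cpl_finite : forall x y, finite_set (B `&` [set z | x < z < y]);
  cpl_slope : forall x, sm x <= sp x;
  cpl_gap : forall x y, gap B x y ->
    g y = g x + sp x * (y - x) /\ sm y = sp x }.

(** Carries the negative half-line to the positive one: the one-sided slopes swap and change
    sign. *)
Lemma convex_pl_reflect (R : realType) (g sp sm : R -> R) (B : set R) :
  convex_pl g sp sm B ->
  convex_pl (fun x => g (- x)) (fun x => - sm (- x)) (fun x => - sp (- x))
    [set x | B (- x)].
Proof.
move=> [Bfin slope affine]; split=> [x y|x|x y [xy gxy]].
- have -> : [set z | B (- z)] `&` [set z | x < z < y]
    = -%R @^-1` (B `&` [set z | - y < z < - x]).
    apply/seteqP; split=> z /= [Bz].
      by move=> /andP[xz zy]; split=> //; rewrite !ltrN2 zy.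
    by rewrite !ltrN2 andbC => xzy; split.
  by apply: finite_preimage (Bfin _ _) => u v _ _; exact: oppr_inj.
- by rewrite lerN2.
- have [|gx sx] := affine (- y) (- x).
    split=> [|z /andP[yz zx]]; first by rewrite ltrN2.
    have := gxy (- z); rewrite /= opprK; apply.
    by rewrite ltrNr zx ltrNl.
  by rewrite gx sx; split=> //; ring.
Qed.

Section ConvexPL.
Variables (R : realType) (g sp sm : R -> R) (B : set R).
Hypothesis cpl : convex_pl g sp sm B.

Lemma convex_pl_chord (x y : R) : x < y ->
  [/\ sp x <= sm y, g x + sp x * (y - x) <= g y & g y <= g x + sm y * (y - x)].
Proof.
move: x y; apply: (gap_ind (B := B)); first exact: cpl_finite cpl.
  by move=> x y /(cpl_gap cpl)[-> ->].
move=> x z y _ /andP[xz zy] [xz1 xz2 xz3] [zy1 zy2 zy3].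
have zz := cpl_slope cpl z; split; first by lra.
  by nra.
by nra.
Qed.

(** The line leaving one breakpoint is the line arriving at the next, so their values at [r]
    coincide and the sum telescopes. *)
Lemma sum_convex_pl_expn (n : nat) (s : seq R) (r : R) :
  uniq s -> (forall z, B z -> 0 < z < r -> z \in s) -> 0 < r ->
  \sum_(z <- s | 0 < z < r)
     ((g z + sp z * (r - z)) ^+ n - (g z + sm z * (r - z)) ^+ n)
  = g r ^+ n - (g 0 + sp 0 * r) ^+ n.
Proof.
move=> us sB r0.
pose A z := (g z + sp z * (r - z)) ^+ n.
pose C z := (g z + sm z * (r - z)) ^+ n.
rewrite (telescope_gap (B := B) (A := A) (C := C))//.
  by rewrite /A /C subrr mulr0 addr0 subr0.
  exact: cpl_finite cpl.
move=> x y /(cpl_gap cpl)[gy sy]; rewrite /A /C gy sy.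
by congr (_ ^+ _); ring.
Qed.

(* Either [g] is eventually nonnegative and nondecreasing, so that only a
   bounded interval matters, or its slopes at positive points stay between
   [sp 0] and [0]. *)
Lemma convex_pl_bad_bounded : exists2 M : R, 0 <= M & forall z, 0 < z ->
  0 <= g z /\ 0 <= sm z \/
  [/\ `|g z| <= M * (1 + z), `|sp z| <= M & `|sm z| <= M].
Proof.
(* Upper bounds suffice: convexity on [[0, z]] gives the lower bounds in terms of [g 0] and
   [sp 0]. *)
have bnd M U : `|g 0| + `|sp 0| + `|U| <= M -> forall z, 0 < z ->
    sp z <= U -> g z <= Num.max (g 0) (M * (1 + z)) ->
    [/\ `|g z| <= M * (1 + z), `|sp z| <= M & `|sm z| <= M].
  move=> MM z z0 zU gz.
  have [c1 c2 c3] := convex_pl_chord z0.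
  have zz := cpl_slope cpl z.
  have := ler_norm (g 0); have := ler_norm (- g 0); rewrite normrN => ??.
  have := ler_norm (sp 0); have := ler_norm (- sp 0); rewrite normrN => ??.
  have := ler_norm U; have := ler_norm (- U); rewrite normrN => ??.
  rewrite !ler_norml; split; last 2 first.
  - by apply/andP; split; lra.
  - by apply/andP; split; lra.
  apply/andP; split; first by nra.
  by move: gz; rewrite le_max => /orP[|//] ?; nra.
have [[x0 [x00 gx0 sx0]]|nx0] := pselect (exists x0, [/\ 0 < x0, 0 <= g x0 & 0 <= sm x0]).
  pose M := `|g 0| + `|sp 0| + `|sm x0| + `|g x0|.
  have M0 : 0 <= M by rewrite !addr_ge0.
  exists M => // z z0; have [zx|xz|->] := ltgtP z x0; last by left.
    right; have [c1 c2 c3] := convex_pl_chord zx.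
    apply: (bnd M (sm x0)) => //; first by rewrite lerDl.
    have [d1 d2 d3] := convex_pl_chord z0.
    have zz := cpl_slope cpl z.
    (* If the right slope at [z] is nonnegative then [g z <= g x0], otherwise [g z <= g 0]. *)
    rewrite le_max; have [sz|sz] := leP 0 (sp z).
      apply/orP; right.
      have := ler_norm (g x0).
      have : `|g x0| <= M by rewrite lerDr !addr_ge0.
      by nra.
    by apply/orP; left; nra.
  left; have [c1 c2 c3] := convex_pl_chord xz.
  have := cpl_slope cpl x0; split; last by lra.
  by nra.
have sm_le0 x : 0 < x -> sm x <= 0.
  move=> x0; rewrite leNgt; apply/negP => sx; apply: nx0.
  have xx := cpl_slope cpl x.
  (* A positive slope at [x] makes up for [g x] within the distance [|g x| / sm x], so [y]
     contradicts [nx0]; the extra [1] ensures [x < y]. *)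
  pose y := x + 1 + `|g x| / sm x.
  have xy : x < y by rewrite /y -addrA ltrDl ltr_wpDr// divr_ge0// ltW.
  have [c1 c2 c3] := convex_pl_chord xy.
  exists y; split; [exact: lt_trans xy| |by lra].
  apply: le_trans c2.
  have : sm x * (y - x) = sm x + `|g x| by rewrite /y; field; rewrite gt_eqF.
  have := ler_norm (- g x); rewrite normrN.
  have : sm x * (y - x) <= sp x * (y - x) by rewrite ler_wpM2r// subr_ge0 ltW.
  by lra.
exists (`|g 0| + `|sp 0|); first by rewrite addr_ge0.
move=> z z0; right; apply: (bnd _ 0) => //; first by rewrite normr0 addr0.
  have [c1 _ _] := convex_pl_chord (ltr_pwDr ltr01 (lexx z)).
  by apply: le_trans c1 (sm_le0 _ _); rewrite addr_gt0.
have [_ _ c3] := convex_pl_chord z0.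
by rewrite le_max; apply/orP; left; have := sm_le0 _ z0; nra.
Qed.

(* Clamping the slopes to [[- M, M]] makes the slope increments of all
   breakpoints telescope to at most [2 * M]. *)
Lemma sum_convex_pl_neg_part (n j : nat) : (j <= n)%N ->
  exists2 K : R, 0 <= K & forall (s : seq R) (r : R), 1 <= r -> uniq s ->
    (forall z, B z -> 0 < z < r -> z \in s) ->
    \sum_(z <- s | 0 < z < r)
       Num.max 0 (- (g z ^+ (n - j) * (sp z ^+ j - sm z ^+ j))) * (r - z) ^+ j
    <= K * r ^+ n.
Proof.
move=> jn; have [M M0 bad] := convex_pl_bad_bounded.
pose phi t := Num.max (- M) (Num.min t M).
have phi_homo : {homo phi : x y / x <= y}.
  by move=> x y xy; rewrite /phi ge_max !le_max lexx /= !le_min !ge_min xy lexx orbT /= orbT.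
have phiE t : `|t| <= M -> phi t = t.
  by rewrite ler_norml => /andP[Mt tM]; rewrite /phi min_l// max_r.
have phi_bnd t : - M <= phi t <= M.
  by rewrite /phi le_max lexx ge_max ge_min lexx orbT andbT ge0_cp//= lerNl; lra.
(* Combines [|g z| <= M * (1 + z) <= 2 * M * r] with the Lipschitz constant of the [j]-th power on
   [[- M, M]]. *)
pose L := (2 * M) ^+ (n - j) * (j%:R * M ^+ j.-1).
have L0 : 0 <= L by rewrite /L !mulr_ge0 ?exprn_ge0 ?mulr_ge0.
exists (L * (2 * M)); first by rewrite mulr_ge0// mulr_ge0.
move=> s r r1 us sB; have r0 : 0 < r by lra.
have := telescope_gap (A := phi \o sp) (C := phi \o sm) (cpl_finite cpl)
  _ us sB r0.
move=> tele.
apply: (@le_trans _ _ (L * r ^+ n * (phi (sm r) - phi (sp 0)))); last first.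
  rewrite mulrAC ler_wpM2r ?(exprn_ge0 _ (ltW r0))// ler_wpM2l//.
  by have := phi_bnd (sm r); have := phi_bnd (sp 0); lra.
rewrite -tele; last by move=> x y /(cpl_gap cpl)[_ sy] /=; rewrite sy.
rewrite mulr_sumr; apply: ler_sum => z /andP[z0 zr].
have zz := cpl_slope cpl z.
have phiz : 0 <= phi (sp z) - phi (sm z) by rewrite subr_ge0 phi_homo.
(* In the first case the jump is nonnegative and its negative part vanishes; in the second the
   clamping [phi] fixes both slopes. *)
have [[gz sz]|[gz spz smz]] := bad z z0.
  rewrite max_l /=.
    rewrite mul0r; apply: mulr_ge0 phiz; apply: mulr_ge0 L0 _.
    exact: exprn_ge0 (ltW r0).
  rewrite oppr_le0 mulr_ge0 ?exprn_ge0// subr_ge0 lerXn2r// nnegrE//.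
  exact: le_trans zz.
rewrite /= !phiE//.
apply: (@le_trans _ _ (`|g z ^+ (n - j) * (sp z ^+ j - sm z ^+ j)| * r ^+ j)).
  apply: ler_pM.
  - by rewrite le_max lexx.
  - by rewrite exprn_ge0// subr_ge0 ltW.
  - by rewrite ge_max normr_ge0 -normrN ler_norm.
  - by rewrite lerXn2r ?nnegrE; lra.
have -> : L * r ^+ n * (sp z - sm z)
    = (2 * M * r) ^+ (n - j) * (j%:R * M ^+ j.-1 * (sp z - sm z)) * r ^+ j.
  by rewrite -{1}(subnK jn) exprD exprMn /L; ring.
rewrite ler_wpM2r ?(exprn_ge0 _ (ltW r0))// normrM ler_pM//.
  rewrite normrX lerXn2r ?nnegrE// ?mulr_ge0//; first lra.
  by apply: le_trans gz _; nra.
have <- : `|sp z - sm z| = sp z - sm z by rewrite ger0_norm// subr_ge0.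
exact: ler_norm_subX.
Qed.

End ConvexPL.

(** * Tropical entire functions as convex piecewise linear functions *)

Lemma horner_size2 (R : comNzRingType) (p : {poly R}) (x y : R) :
  (size p <= 2)%N ->
  p.[y] = p.[x] + p`_1 * (y - x) /\ (p^`(1)).[x] = p`_1.
Proof.
move=> p2; rewrite !(horner_coef_wide _ p2) !big_ord_recl !big_ord0 /=.
rewrite (horner_coef_wide _ (_ : (size p^`(1) <= 1)%N)).
  by rewrite big_ord1 coef_derivn /= addn0 ffactn1 mulr1n; split; ring.
apply/leq_sizeP => -[//|i _]; rewrite coef_derivn.
by rewrite (leq_sizeP _ _ p2)// mul0rn.
Qed.

(** If all terms stayed on one side of [x], a whole tail of the strictly monotone sequence would be
    trapped in a bounded interval. *)
Lemma int_sequence_locate (R : realType) (b : int -> R) :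
  {homo b : k l / k < l} ->
  (forall x y, finite_set (range b `&` [set z | x < z < y])) ->
  forall x, exists k, b k <= x < b (k + 1).
Proof.
move=> bhomo bfin x.
have binj (f : nat -> int) (u v : R) : injective f ->
    ~ (forall i, u < b (f i) < v).
  move=> finj fuv; apply: infinite_nat.
  have -> : [set: nat] = (b \o f) @^-1` (range b `&` [set z | u < z < v]).
    by apply/esym/seteqP; split=> // i _ /=; split; [exists (f i)|exact: fuv].
  apply: finite_preimage (bfin _ _) => i j _ _ /= bij; apply: finj.
  have [ij|ij|//] := ltgtP (f i) (f j).
    by have := bhomo _ _ ij; rewrite bij ltxx.
  by have := bhomo _ _ ij; rewrite bij ltxx.
have [k bk] : exists k, b k <= x.
  apply: contrapT => nb.
  apply: (binj (fun i => - i.+1%:Z) x (b 0)) => [i j /oppr_inj[]//|i].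
  by rewrite bhomo// andbT ltNge; apply/negP => bx; apply: nb; exists (- i.+1%:Z).
have [i bi] : exists i : nat, x < b (k + i%:Z).
  apply: contrapT => nb.
  apply: (binj (fun i => k + i.+1%:Z) (b k) (x + 1)) => [i j /addrI[]//|i].
  rewrite bhomo/= ?ltrDl// ltr_pwDr// leNgt.
  by apply/negP => bx; apply: nb; exists i.+1.
case: (ex_minnP (ex_intro (fun i : nat => x < b (k + i%:Z)) i bi)) => -[|j] xj jmin.
  by move: xj; rewrite addr0 ltNge bk.
exists (k + j%:Z); rewrite -addrA -PoszD addn1 xj andbT leNgt.
by apply/negP => /jmin; rewrite ltnn.
Qed.

Lemma constant_convex_pl (R : realType) (g : R -> R) :
  constant_fun g -> convex_pl g (derive_right 1 g) (derive_left 1 g) set0.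
Proof.
move=> [c gc].
have d0 x : (c%:P^`(1)).[x] = 0 :> R by rewrite derivn1 derivC horner0.
have dr x : derive_right 1 g x = 0.
  rewrite (derive_right_horner (p := c%:P) (b := x + 1))// ?ltrDl// => y _.
  by rewrite hornerC.
have dl x : derive_left 1 g x = 0.
  rewrite (derive_left_horner (p := c%:P) (a := x - 1))// ?gtrDl ?oppr_lt0// => y _.
  by rewrite hornerC.
split=> [x y|x|x y _]; first by rewrite set0I; exact: finite_set0.
  by rewrite dr dl.
by rewrite !gc dr dl mul0r addr0.
Qed.

(** The absence of first poles makes the slopes nondecreasing, and on a gap [g] is a single
    polynomial of degree at most one. *)
Lemma trop_entire_convex_pl (R : realType) (g : R -> R) :
  trop_entire 1 g ->
  exists B, convex_pl g (derive_right 1 g) (derive_left 1 g) B.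
Proof.
move=> [[_ [b [p [bhomo blim gp psize _]]]] nopole].
have bfin x y : finite_set (range b `&` [set z | x < z < y]).
  (* Bolzano-Weierstrass: infinitely many breakpoints in a bounded interval would accumulate. *)
  apply: contrapT => /infinite_bounded_limit_point_nonempty[|l llim].
    exists (`|x| + `|y|); split; first exact: num_real.
    move=> M /ltW xyM z [_ /andP[xz zy]].
    apply: le_trans xyM; have := ler_norm y; have := ler_norm (- x).
    have := normr_ge0 x; have := normr_ge0 y; rewrite normrN => ? ? ? ?.
    by rewrite ler_norml; apply/andP; split; lra.
  suff : limit_point (range b) l by rewrite blim.
  by move=> U /llim[z [zl [bz _] Uz]]; exists z.
have p2 k : (size (p k) <= 2)%N by have := psize k; case: size => [|[|[]]].
exists (range b); split=> // [x|x y [xy gxy]].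
  have := nopole 1 x isT; rewrite /jpole /omega => /negP; rewrite -leNgt.
  rewrite factS fact0 muln1 invr1 mul1r subr_ge0.
  (* For [j = 1] the signs enter squared, so the sign convention drops out, even at [0]. *)
  have sgr2 (t : R) : (sgr_right t ^+ 2 = 1) * (sgr_left t ^+ 2 = 1).
    rewrite /sgr_right /sgr_left; case: ifP => [_|/negbT t0].
      by rewrite expr1n sqrrN expr1n.
    by rewrite sqr_sg t0.
  by rewrite !sgr2 !mul1r.
have [k /andP[bx xb]] := int_sequence_locate bhomo bfin x.
have yb : y <= b (k + 1).
  rewrite leNgt; apply/negP => bky; apply: (gxy (b (k + 1))).
    by rewrite xb.
  by exists (k + 1).
have gk z : x <= z <= y -> g z = (p k).[z].
  by move=> /andP[xz zy]; apply: gp; rewrite (le_trans bx xz) (le_trans zy yb).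
have [py dpx] := horner_size2 x y (p2 k).
have [_ dpy] := horner_size2 y y (p2 k).
rewrite (derive_right_horner (p := p k) _ xy); last first.
  by move=> z /andP[xz zy]; rewrite gk// !ltW.
rewrite (derive_left_horner (p := p k) _ xy); last first.
  by move=> z /andP[xz zy]; rewrite gk// !ltW.
by rewrite dpx dpy !gk ?lexx ?ltW.
Qed.

(** Provides one breakpoint set for all components: a gap of the union is a gap of each [B i]. *)
Lemma convex_pl_bigcup (R : realType) (m : nat) (ff sp sm : 'I_m -> R -> R)
    (B : 'I_m -> set R) :
  (forall i, convex_pl (ff i) (sp i) (sm i) (B i)) ->
  forall i, convex_pl (ff i) (sp i) (sm i) (\bigcup_i B i).
Proof.
move=> cpl i; split=> [x y|x|x y [xy gxy]]; last 2 first.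
- exact: cpl_slope (cpl i) x.
- apply: (cpl_gap (cpl i)); split=> // z /gxy nz Bz; apply: nz; by exists i.
rewrite setI_bigcupl; apply: bigcup_finite => // k _.
exact: cpl_finite (cpl k) x y.
Qed.

Section GapExistence.
Variables (R : realType) (B : set R).
Hypothesis Bfin : forall x y, finite_set (B `&` [set z | x < z < y]).

Lemma gap_right (x : R) : exists y, gap B x y.
Proof.
have : x < x + 1 by rewrite ltrDl.
apply: (gap_ind (B := B) (Q := fun x _ => exists y, gap B x y)) => //.
by move=> {}x y gxy; exists y.
Qed.

Lemma gap_left (x : R) : exists y, gap B y x.
Proof.
have : x - 1 < x by rewrite gtrDl oppr_lt0.
apply: (gap_ind (B := B) (Q := fun _ x => exists y, gap B y x)) => //.
by move=> y {}x gxy; exists y.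
Qed.

End GapExistence.

Lemma gap_trans (R : realType) (B : set R) (x z y : R) :
  ~ B z -> gap B x z -> gap B z y -> gap B x y.
Proof.
move=> Bz [xz gxz] [zy gzy]; split; first exact: lt_trans zy.
move=> w /andP[xw wy]; have [wz|zw|->//] := ltgtP w z.
  by apply: gxz; rewrite xw.
by apply: gzy; rewrite zw.
Qed.

(** A point off [B] is interior to a gap, which carries a single slope. *)
Lemma convex_pl_smooth (R : realType) (g sp sm : R -> R) (B : set R) (z : R) :
  convex_pl g sp sm B -> ~ B z -> sm z = sp z.
Proof.
move=> cpl Bz; have Bfin := cpl_finite cpl.
have [x gxz] := gap_left Bfin z; have [y gzy] := gap_right Bfin z.
have [_ ->] := cpl_gap cpl gxz; have [_ <-] := cpl_gap cpl gzy.
by have [_ ->] := cpl_gap cpl (gap_trans Bz gxz gzy).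
Qed.

(** * Jumps of powers of convex piecewise linear functions *)

(* [omega j (g ^+ n) z], for [g] piecewise linear with one-sided slopes
   [sp] and [sm]. *)
Definition expn_jump (R : realType) (n j : nat) (g sp sm : R -> R) (z : R) : R :=
  'C(n, j)%:R * (g z ^+ (n - j)
    * (sgr_right z ^+ j.+1 * sp z ^+ j - sgr_left z ^+ j.+1 * sm z ^+ j)).

(** Each component is affine on either side of [z], and the falling factorial from the [j]-th
    derivative divided by [j!] is the binomial coefficient. *)
Lemma omega_sum_expn (R : realType) (m n j : nat) (alpha : 'I_m -> R)
    (ff sp sm : 'I_m -> R -> R) (B : set R) (z : R) :
  (forall x y, finite_set (B `&` [set z | x < z < y])) ->
  (forall i, convex_pl (ff i) (sp i) (sm i) B) ->
  omega j (fun x => \sum_(i < m) alpha i * ff i x ^+ n) z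
  = \sum_(i < m) alpha i * expn_jump n j (ff i) (sp i) (sm i) z.
Proof.
move=> Bfin cpl.
have [x gxz] := gap_left Bfin z; have [y gzy] := gap_right Bfin z.
rewrite /omega.
rewrite (derive_right_sum_affine_exp (n := n) (alpha := alpha)
  (c := ff ^~ z) (s := sp ^~ z) _ gzy.1); last first.
  move=> w /andP[zw wy]; apply: eq_bigr => i _.
  have [|-> _//] := cpl_gap (cpl i) (_ : gap B z w).
  split=> // v /andP[zv vw]; apply: gzy.2; rewrite zv.
  exact: lt_trans wy.
rewrite (derive_left_sum_affine_exp (n := n) (alpha := alpha)
  (c := ff ^~ z) (s := sm ^~ z) _ gxz.1); last first.
  move=> w /andP[xw wz]; apply: eq_bigr => i _.
  have [|-> ->] := cpl_gap (cpl i) (_ : gap B w z).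
    split=> // v /andP[wv vz]; apply: gxz.2; rewrite vz andbT.
    exact: lt_trans wv.
  by congr (_ * _ ^+ _); ring.
rewrite !mulr_sumr -sumrB mulr_sumr; apply: eq_bigr => i _.
rewrite /expn_jump -bin_ffact natrM; field.
by rewrite pnatr_eq0 -lt0n fact_gt0.
Qed.

Lemma expn_jump_pos (R : realType) (n j : nat) (g sp sm : R -> R) (z : R) :
  0 < z -> expn_jump n j g sp sm z
           = 'C(n, j)%:R * (g z ^+ (n - j) * (sp z ^+ j - sm z ^+ j)).
Proof.
move=> z0; rewrite /expn_jump /sgr_right /sgr_left gt_eqF// gtr0_sg//.
by rewrite expr1n !mul1r.
Qed.

(** The sign [(-1) ^+ j.+1] at [- z] is exactly what reflecting the slopes produces. *)
Lemma expn_jump_neg (R : realType) (n j : nat) (g sp sm : R -> R) (z : R) :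
  0 < z -> expn_jump n j g sp sm (- z)
  = expn_jump n j (fun x => g (- x)) (fun x => - sm (- x)) (fun x => - sp (- x)) z.
Proof.
move=> z0; rewrite [RHS]expn_jump_pos// /expn_jump /sgr_right /sgr_left.
rewrite oppr_eq0 gt_eqF// ltr0_sg ?oppr_lt0//.
by rewrite [(- sm _) ^+ j]exprNn [(- sp _) ^+ j]exprNn exprS; ring.
Qed.

(** At the origin the convention adds the contributions of the two outward slopes [sp 0] and
    [- sm 0]. *)
Lemma expn_jump0 (R : realType) (n j : nat) (g sp sm : R -> R) :
  expn_jump n j g sp sm 0
  = 'C(n, j)%:R * (g 0 ^+ (n - j) * (sp 0 ^+ j + (- sm 0) ^+ j)).
Proof.
rewrite /expn_jump /sgr_right /sgr_left eqxx expr1n mul1r exprS -mulrA mulN1r.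
by rewrite -exprMn mulN1r opprK.
Qed.

Lemma expn_jump_smooth (R : realType) (n j : nat) (g sp sm : R -> R) (z : R) :
  z != 0 -> sm z = sp z -> expn_jump n j g sp sm z = 0.
Proof.
move=> z0 spm; rewrite /expn_jump /sgr_right /sgr_left (negbTE z0) spm subrr.
by rewrite !mulr0.
Qed.

(** The origin is always listed: by the sign convention it can carry a nonzero jump even off [B]. *)
Definition breakpoint_list (R : realType) (B : set R) (r : R) (s : seq R) : Prop :=
  [/\ uniq s, 0 \in s, forall z, z \in s -> - r < z < r
    & forall z, B z -> - r < z < r -> z \in s].

Lemma sum_breakpoint_split (R : realType) (B : set R) (r : R) (s : seq R)
    (X : R -> R) : 0 < r -> breakpoint_list B r s ->
  \sum_(z <- s) X z = \sum_(z <- s | 0 < z < r) X z + X 0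
                      + \sum_(z <- map -%R s | 0 < z < r) X (- z).
Proof.
move=> r0 [us s0 sr _].
have -> : \sum_(z <- s) X z = \sum_(z <- s | - r < z < r) X z.
  rewrite big_seq [RHS]big_seq_cond; apply: eq_bigl => z.
  by case: (boolP (z \in s)) => // /sr ->.
rewrite (sum_itv_split _ us s0) ?oppr_lt0 ?r0// big_map addrC addrA.
rewrite [X in _ = _ + X](eq_big (fun z => - r < z < 0) X)//; first by ring.
  by move=> z; rewrite oppr_gt0 ltrNl andbC.
by move=> z _; rewrite opprK.
Qed.

Section ExpnJumpSums.
Variables (R : realType) (g sp sm : R -> R) (B : set R).
Hypothesis cpl : convex_pl g sp sm B.

Let cplN := convex_pl_reflect cpl.

Let breakpoint_half (r : R) (s : seq R) : breakpoint_list B r s ->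
  forall z, B z -> 0 < z < r -> z \in s.
Proof.
move=> [_ _ _ sB] z Bz /andP[z0 zr]; apply: sB => //.
by rewrite zr andbT; lra.
Qed.

Let breakpoint_opp (r : R) (s : seq R) : breakpoint_list B r s ->
  uniq (map -%R s) /\
  forall z, [set x | B (- x)] z -> 0 < z < r -> z \in map -%R s.
Proof.
move=> [us _ _ sB]; split; first by rewrite map_inj_uniq//; exact: oppr_inj.
move=> z Bz /andP[z0 zr]; rewrite -[z]opprK map_f//; apply: sB => //.
by rewrite ltrN2 zr; lra.
Qed.

(** The term at [0] evaluates the two rays leaving the origin at distance [r], which cancels the
    boundary terms left by telescoping on each half-line. *)
Lemma tropical_jensen_expn (n : nat) (r : R) (s : seq R) :
  0 < r -> breakpoint_list B r s ->
  \sum_(z <- s) \sum_(1 <= j < n.+1)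
     expn_jump n j g sp sm z * (r - `|z|) ^+ j
  = g r ^+ n + g (- r) ^+ n - 2 * g 0 ^+ n.
Proof.
move=> r0 sB; have [us _ _ _] := sB; have [usN sBN] := breakpoint_opp sB.
have half (h hp hm : R -> R) z : 0 < z ->
    \sum_(1 <= j < n.+1) expn_jump n j h hp hm z * (r - z) ^+ j
    = (h z + hp z * (r - z)) ^+ n - (h z + hm z * (r - z)) ^+ n.
  (* The sum over [j] starts at [1], so the missing term [h z ^+ n] is inserted on both sides of the
     difference. *)
  move=> z0; have ins (a b c : R) : a - b = a - c - (b - c) by ring.
  rewrite [RHS](ins _ _ (h z ^+ n)) -!sum_binomial_tail -sumrB.
  apply: eq_bigr => j _.
  by rewrite expn_jump_pos//; ring.
rewrite (sum_breakpoint_split _ r0 sB) normr0 subr0.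
rewrite (eq_bigr (fun z => (g z + sp z * (r - z)) ^+ n
                           - (g z + sm z * (r - z)) ^+ n)); last first.
  by move=> z /andP[z0 _]; rewrite gtr0_norm// half.
rewrite [X in _ + X](eq_bigr (fun z =>
    (g (- z) + - sm (- z) * (r - z)) ^+ n
    - (g (- z) + - sp (- z) * (r - z)) ^+ n)); last first.
  move=> z /andP[z0 _]; rewrite normrN gtr0_norm//.
  rewrite -(half (fun x => g (- x)) (fun x => - sm (- x)) (fun x => - sp (- x)))//.
  by apply: eq_bigr => j _; rewrite expn_jump_neg.
rewrite (sum_convex_pl_expn cpl n us (breakpoint_half sB) r0).
rewrite (sum_convex_pl_expn cplN n usN sBN r0) oppr0.
rewrite (eq_bigr (fun j => 'C(n, j)%:R * (g 0 ^+ (n - j) * sp 0 ^+ j) * r ^+ j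
    + 'C(n, j)%:R * (g 0 ^+ (n - j) * (- sm 0) ^+ j) * r ^+ j)); last first.
  by move=> j _; rewrite expn_jump0; ring.
by rewrite big_split /= !sum_binomial_tail; ring.
Qed.

(** Both half-lines reduce to the bound at positive breakpoints; the term at [0] is a constant times
    [r ^+ j <= r ^+ n]. *)
Lemma expn_jump_neg_part (n j : nat) : (j <= n)%N ->
  exists2 K : R, 0 <= K & forall (r : R) (s : seq R),
    1 <= r -> breakpoint_list B r s ->
    \sum_(z <- s) Num.max 0 (- expn_jump n j g sp sm z) * (r - `|z|) ^+ j
    <= K * r ^+ n.
Proof.
move=> jn; have [K K0 boundK] := sum_convex_pl_neg_part cpl jn.
have [L L0 boundL] := sum_convex_pl_neg_part cplN jn.
pose E := `|expn_jump n j g sp sm 0|.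
exists ('C(n, j)%:R * K + E + 'C(n, j)%:R * L).
  by rewrite !addr_ge0 ?mulr_ge0 /E ?normr_ge0.
move=> r s r1 sB; have r0 : 0 < r by lra.
have [us _ _ _] := sB; have [usN sBN] := breakpoint_opp sB.
rewrite (sum_breakpoint_split _ r0 sB) normr0 subr0 !mulrDl.
apply: lerD; first apply: lerD.
- rewrite -mulrA.
  apply: le_trans (ler_wpM2l (ler0n _ _) (boundK s r r1 us (breakpoint_half sB))).
  rewrite mulr_sumr; apply: ler_sum => z /andP[z0 _].
  by rewrite gtr0_norm// expn_jump_pos// -mulrN mulrA maxr_pMr// mulr0.
- apply: ler_pM.
  + by rewrite le_max lexx.
  + exact: exprn_ge0 (ltW r0).
  + by rewrite ge_max normr_ge0 /E -normrN ler_norm.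
  + exact: ler_weXn2l.
- rewrite -mulrA.
  apply: le_trans (ler_wpM2l (ler0n _ _) (boundL _ r r1 usN sBN)).
  rewrite mulr_sumr; apply: ler_sum => z /andP[z0 _].
  rewrite normrN gtr0_norm// expn_jump_neg// expn_jump_pos// -mulrN mulrA.
  by rewrite maxr_pMr// mulr0.
Qed.

End ExpnJumpSums.

(** * Counting functions and the Cartan characteristic *)

Lemma breakpoint_list_exists (R : realType) (B : set R) (r : R) :
  (forall x y, finite_set (B `&` [set z | x < z < y])) -> 0 < r ->
  exists s, breakpoint_list B r s.
Proof.
move=> Bfin r0; pose D := (B `&` [set z | - r < z < r]) `|` [set 0].
have Dfin : finite_set D by rewrite /D finite_setU.
exists (fset_set D); split.
- exact: fset_uniq.
- by rewrite in_fset_set//; apply/mem_set; right.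
- move=> z; rewrite in_fset_set// => /set_mem[[]//|/= ->].
  by rewrite oppr_lt0 r0.
- by move=> z Bz zr; rewrite in_fset_set//; apply/mem_set; left.
Qed.

Section CountingFunction.
Variables (R : realType) (m n : nat) (alpha : 'I_m.+1 -> R).
Variables (ff sp sm : 'I_m.+1 -> R -> R) (B : set R).
Hypothesis cpl : forall i, convex_pl (ff i) (sp i) (sm i) B.
Hypothesis alpha0 : forall i, 0 < alpha i.

Let Bfin := cpl_finite (cpl ord0).
Let neg_comp x := trop_div (trop_one R) (fermat_comp n alpha ff x).
(** The jump of [P o f] itself; the poles of [neg_comp] are the points where it is positive. *)
Let w j z := \sum_(i < m.+1) alpha i * expn_jump n j (ff i) (sp i) (sm i) z.

Let omega_neg_comp j z : omega j neg_comp z = - w j z.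
Proof.
have -> : neg_comp = fun x => \sum_(i < m.+1) (- alpha i) * ff i x ^+ n.
  apply/funext => x; rewrite /neg_comp /trop_div /trop_one /fermat_comp.
  by rewrite /fermat_poly sub0r -sumrN; apply: eq_bigr => i _; rewrite mulNr.
rewrite (omega_sum_expn _ _ _ _ Bfin cpl) -sumrN.
by apply: eq_bigr => i _; rewrite mulNr.
Qed.

(** One finite list serves every [j]: off the list [w] vanishes, and at listed points that are not
    poles the maximum is [0]. *)
Let trop_N_sum j r s : 0 < r -> breakpoint_list B r s ->
  trop_N j r neg_comp
  = 2^-1 * \sum_(z <- s) Num.max 0 (w j z) * (r - `|z|) ^+ j.
Proof.
move=> r0 [us s0 sr sB]; congr (_ * _).
have sfin : finite_set [set` s] by exact: finite_seq.
rewrite [RHS](fsbig_seq _ _ us) -(fsbig_widen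
  [set z : R | - r < z < r /\ jpole j neg_comp z]).
- apply: eq_fsbigr => z /set_mem[_]; rewrite /jpole omega_neg_comp oppr_lt0 => wz.
  by rewrite normrN gtr0_norm// max_r// ltW.
- move=> z [zr]; rewrite /jpole omega_neg_comp oppr_lt0 => wz /=.
  apply: contrapT => zs.
  have Bz : ~ B z by move=> Bz; apply: zs; exact: sB.
  have z0 : z != 0 by apply/eqP => z0; apply: zs; rewrite z0.
  move: wz; rewrite /w big1 ?ltxx// => i _.
  by rewrite expn_jump_smooth ?mulr0//; exact: convex_pl_smooth (cpl i) Bz.
- move=> z [/= zs nz]; rewrite max_l ?mul0r//.
  rewrite leNgt; apply/negP => wz; apply: nz; split; first exact: sr.
  by rewrite /jpole omega_neg_comp oppr_lt0.
Qed.

(** The symmetric mean of [P o f] at [r] and [- r], minus its value at [0]. *)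
Let jensen_sum (r : R) : R :=
  2^-1 * \sum_(i < m.+1)
           alpha i * (ff i r ^+ n + ff i (- r) ^+ n - 2 * ff i 0 ^+ n).

Let jensen_sumE r s : 0 < r -> breakpoint_list B r s ->
  jensen_sum r
  = 2^-1 * \sum_(1 <= j < n.+1) \sum_(z <- s) w j z * (r - `|z|) ^+ j.
Proof.
move=> r0 sB; congr (_ * _); rewrite exchange_big /=.
rewrite (eq_bigr (fun i => \sum_(z <- s) \sum_(1 <= j < n.+1)
    alpha i * (expn_jump n j (ff i) (sp i) (sm i) z * (r - `|z|) ^+ j))).
  rewrite exchange_big /=; apply: eq_bigr => z _.
  rewrite exchange_big /=; apply: eq_bigr => j _.
  by rewrite /w mulr_suml; apply: eq_bigr => i _; rewrite mulrA.
move=> i _; rewrite -(tropical_jensen_expn (cpl i) n r0 sB) mulr_sumr.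
by apply: eq_bigr => z _; rewrite mulr_sumr.
Qed.

(** Dropping the roots gives the lower bound. For the upper one, the positive part of a sum of jumps
    exceeds the sum by at most the weighted negative parts of the components. *)
Lemma sum_trop_N_bounds : exists2 K : R, 0 <= K & forall r, 1 <= r ->
  jensen_sum r <= \sum_(1 <= j < n.+1) trop_N j r neg_comp
               <= jensen_sum r + K * r ^+ n.
Proof.
(* The condition [j <= n] sits under the existential so that [choice] yields constants for all
   pairs, with a dummy value when [j > n]. *)
have : forall ij : 'I_m.+1 * nat, exists K : R, (ij.2 <= n)%N ->
    0 <= K /\ forall r s, 1 <= r -> breakpoint_list B r s ->
    \sum_(z <- s) Num.max 0 (- expn_jump n ij.2 (ff ij.1) (sp ij.1) (sm ij.1) z)
                  * (r - `|z|) ^+ ij.2 <= K * r ^+ n.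
  move=> [i j] /=; have [jn|_] := boolP (j <= n)%N; last by exists 0.
  by have [K K0 KP] := expn_jump_neg_part (cpl i) jn; exists K.
move=> /choice[K KP].
exists (2^-1 * \sum_(1 <= j < n.+1) \sum_(i < m.+1) alpha i * K (i, j)).
  rewrite mulr_ge0// big_nat sumr_ge0// => j /andP[_ jn].
  rewrite sumr_ge0// => i _; rewrite mulr_ge0 ?(ltW (alpha0 i))//.
  by have [] := KP (i, j) jn.
move=> r r1; have r0 : 0 < r := lt_le_trans ltr01 r1.
have [s sB] := breakpoint_list_exists Bfin r0; have [_ _ sr _] := sB.
have rz j z : z \in s -> 0 <= (r - `|z|) ^+ j.
  by move=> /sr /andP[rz zr]; rewrite exprn_ge0// subr_ge0 ler_norml !ltW.
rewrite (eq_bigr (fun j => 2^-1 * \sum_(z <- s) Num.max 0 (w j z) * (r - `|z|) ^+ j));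
  last by move=> j _; exact: trop_N_sum.
rewrite -mulr_sumr (jensen_sumE r0 sB) -mulrA -mulrDr !ler_pM2l ?invr_gt0//.
apply/andP; split.
  apply: ler_sum => j _; rewrite big_seq [leRHS]big_seq; apply: ler_sum => z zs.
  by rewrite ler_wpM2r ?rz// le_max lexx orbT.
rewrite mulr_suml -big_split /= big_nat [leRHS]big_nat; apply: ler_sum => j /andP[_ jn].
rewrite mulr_suml; pose v i z := expn_jump n j (ff i) (sp i) (sm i) z.
apply: (@le_trans _ _ (\sum_(z <- s) w j z * (r - `|z|) ^+ j + \sum_(i < m.+1)
   alpha i * \sum_(z <- s) Num.max 0 (- v i z) * (r - `|z|) ^+ j)); last first.
  rewrite lerD2l; apply: ler_sum => i _; rewrite -mulrA ler_wpM2l ?(ltW (alpha0 i))//.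
  by have [_] := KP (i, j) jn; apply.
rewrite (eq_bigr (fun i => \sum_(z <- s)
    alpha i * (Num.max 0 (- v i z) * (r - `|z|) ^+ j))); last first.
  by move=> i _; rewrite mulr_sumr.
rewrite exchange_big -big_split /= big_seq [leRHS]big_seq; apply: ler_sum => z zs.
under eq_bigr do rewrite mulrA.
rewrite -mulr_suml -mulrDl ler_wpM2r ?rz// /w -big_split ge_max /=.
apply/andP; split.
  apply: sumr_ge0 => i _; rewrite -mulrDr mulr_ge0 ?(ltW (alpha0 i))//.
  by rewrite -lerBlDl sub0r le_max lexx orbT.
apply: ler_sum => i _; rewrite lerDl mulr_ge0 ?(ltW (alpha0 i))//.
by rewrite le_max lexx.
Qed.

End CountingFunction.

(** * Elementary inequalities for powers *)

Section RealPowers.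
Variable R : realFieldType.
Implicit Types a b d x y : R.

Lemma addX_le_exprD a b n : 0 <= a -> 0 <= b -> (0 < n)%N ->
  a ^+ n + b ^+ n <= (a + b) ^+ n.
Proof.
move=> a0 b0; case: n => // n _; elim: n => [|n IHn]; first by rewrite !expr1.
rewrite [leRHS]exprS; apply: le_trans (ler_wpM2l (addr_ge0 a0 b0) IHn).
rewrite [a ^+ n.+2]exprS [b ^+ n.+2]exprS.
have := mulr_ge0 a0 (exprn_ge0 n.+1 b0); have := mulr_ge0 b0 (exprn_ge0 n.+1 a0).
by lra.
Qed.

(** Induction on [n]; the step is Chebyshev's inequality for the equally ordered pairs [(a, b)] and
    [(a ^+ n, b ^+ n)]. *)
Lemma exprn_midpoint_le a b n : 0 <= a -> 0 <= b ->
  ((a + b) / 2) ^+ n <= (a ^+ n + b ^+ n) / 2.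
Proof.
move=> a0 b0; elim: n => [|n IHn]; first by rewrite !expr0; lra.
have ab0 : 0 <= (a + b) / 2 by lra.
rewrite exprS; apply: le_trans (ler_wpM2l ab0 IHn) _.
have : 0 <= (a - b) * (a ^+ n - b ^+ n).
  have [ab|/ltW ab] := leP a b.
    by rewrite mulr_le0// subr_le0// lerXn2r.
  by rewrite mulr_ge0// subr_ge0// lerXn2r.
by rewrite !exprS; lra.
Qed.

(** A negative [x] has absolute value at most [d], so replacing it by its positive part costs at
    most [d ^+ n]. *)
Lemma exprn_ge_pos_part x d n : 0 <= d -> - d <= x -> (0 < n)%N ->
  Num.max 0 x ^+ n - d ^+ n <= x ^+ n.
Proof.
move=> d0 dx n0; have [x0|x0] := leP 0 x.
  by rewrite gerBl exprn_ge0.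
rewrite expr0n eqn0Ngt n0 sub0r lerNl.
apply: (le_trans (ler_norm _)); rewrite normrN normrX lerXn2r ?nnegrE//.
by rewrite ltr0_norm//; lra.
Qed.

Lemma exprn_le_pos_part x y d n : 0 <= d -> 0 <= y -> - d <= x <= y ->
  x ^+ n <= y ^+ n + d ^+ n.
Proof.
move=> d0 y0 /andP[dx xy]; have [x0|x0] := leP 0 x.
  apply: (@le_trans _ _ (y ^+ n)); first by rewrite lerXn2r ?nnegrE.
  by rewrite lerDl exprn_ge0.
apply: (@le_trans _ _ (d ^+ n)); last by rewrite lerDr exprn_ge0.
apply: (le_trans (ler_norm _)); rewrite normrX lerXn2r ?nnegrE//.
by rewrite ltr0_norm//; lra.
Qed.

End RealPowers.

(** * Comparison of the pole count with the Cartan characteristic *)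

Section CartanCharacteristic.
Variables (R : realType) (m n : nat) (alpha : 'I_m.+1 -> R).
Variables (ff sp sm : 'I_m.+1 -> R -> R) (B : set R).
Hypothesis cpl : forall i, convex_pl (ff i) (sp i) (sm i) B.
Hypothesis alpha0 : forall i, 0 < alpha i.
Hypothesis n0 : (0 < n)%N.

Let theta : R := \big[Num.min/alpha ord0]_(i < m.+1) alpha i.
Let A : R := \sum_(i < m.+1) alpha i.

Lemma cartan_F_attained x : exists i, cartan_F ff x = ff i x.
Proof.
rewrite /cartan_F; elim/big_ind: _ => [|u v [i ->] [j ->]|i _].
- by exists ord0.
- by case: leP => _; [exists j|exists i].
- by exists i.
Qed.

Lemma cartan_F_ge i x : ff i x <= cartan_F ff x.
Proof. exact: le_bigmax. Qed.

Lemma bigmin_coef_gt0 : 0 < theta.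
Proof.
rewrite /theta; elim/big_ind: _ => [|u v u0 v0|i _]; rewrite ?alpha0//.
by rewrite lt_min u0.
Qed.

(** The component attaining the maximum at [0] is convex and lies below [F] at [r] and [- r]. *)
Lemma cartan_T_ge0 r : 0 < r -> 0 <= cartan_T ff r.
Proof.
move=> r0; have [i Fi] := cartan_F_attained 0.
have := cartan_F_ge i r; have := cartan_F_ge i (- r).
have [_ + _] := convex_pl_chord (cpl i) r0.
have [_ + _] := convex_pl_chord (convex_pl_reflect (cpl i)) r0.
rewrite /= !subr0 !oppr0 /cartan_T Fi.
have := cpl_slope (cpl i) 0; by nra.
Qed.

(** A convex function lies above its supporting lines at [0]; [r >= 1] absorbs the constant term. *)
Lemma convex_pl_linear_lower_bound : exists2 C : R, 0 <= C &
  forall i r, 1 <= r -> - (C * r) <= ff i r /\ - (C * r) <= ff i (- r).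
Proof.
exists (\sum_(i < m.+1) (`|ff i 0| + `|sp i 0| + `|sm i 0|)).
  by rewrite sumr_ge0// => i _; rewrite !addr_ge0.
move=> i r r1; have r0 : 0 < r := lt_le_trans ltr01 r1.
rewrite (bigD1 i)//=; set D := \sum_(k < _ | _) _.
have D0 : 0 <= D by rewrite sumr_ge0// => k _; rewrite !addr_ge0.
have [_ + _] := convex_pl_chord (cpl i) r0.
have [_ + _] := convex_pl_chord (convex_pl_reflect (cpl i)) r0.
rewrite /= !subr0 !oppr0.
have := ler_norm (- ff i 0); rewrite normrN; have := normr_ge0 (ff i 0).
have := ler_norm (- sp i 0); rewrite normrN; have := normr_ge0 (sp i 0).
have := ler_norm (sm i 0); have := normr_ge0 (sm i 0).
by move=> *; split; nra.
Qed.

(** The lower bound keeps only the positive part of a component attaining the maximum; the upper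
    bound replaces every component by that maximum. *)
Lemma fermat_sum_bounds (x d : R) : 0 <= d -> (forall i, - d <= ff i x) ->
  theta * Num.max 0 (cartan_F ff x) ^+ n - A * d ^+ n
  <= \sum_(i < m.+1) alpha i * ff i x ^+ n
  <= A * Num.max 0 (cartan_F ff x) ^+ n + A * d ^+ n.
Proof.
move=> d0 dx; have F0 : 0 <= Num.max 0 (cartan_F ff x) by rewrite le_max lexx.
apply/andP; split; last first.
  rewrite -mulrDr mulr_suml; apply: ler_sum => i _.
  rewrite ler_wpM2l ?(ltW (alpha0 i))//; apply: exprn_le_pos_part => //.
  by rewrite dx le_max cartan_F_ge orbT.
apply: (@le_trans _ _ (\sum_(i < m.+1) alpha i * (Num.max 0 (ff i x) ^+ n - d ^+ n))).
  under eq_bigr do rewrite mulrBr.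
  rewrite sumrB -mulr_suml lerD2r; have [i ->] := cartan_F_attained x.
  rewrite (bigD1 i)//= -[leLHS]addr0 lerD//.
    by rewrite ler_wpM2r ?bigmin_le// exprn_ge0// le_max lexx.
  rewrite sumr_ge0// => k _; rewrite mulr_ge0 ?(ltW (alpha0 k))// exprn_ge0//.
  by rewrite le_max lexx.
apply: ler_sum => i _; rewrite ler_wpM2l ?(ltW (alpha0 i))//.
exact: exprn_ge_pos_part.
Qed.

Let neg_comp x := trop_div (trop_one R) (fermat_comp n alpha ff x).

Lemma sum_trop_N_cartan_bounds : exists c D : R, [/\ 0 <= c, 0 <= D &
  forall r, 1 <= r -> c * r <= cartan_T ff r ->
  theta * (cartan_T ff r - c * r) ^+ n - D * r ^+ n
  <= \sum_(1 <= j < n.+1) trop_N j r neg_comp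
  <= 2 ^+ n.-1 * A * (cartan_T ff r + c * r) ^+ n + D * r ^+ n].
Proof.
have [K K0 NP] := sum_trop_N_bounds n cpl alpha0.
have [C C0 fC] := convex_pl_linear_lower_bound.
have A0 : 0 <= A by rewrite sumr_ge0// => i _; rewrite ltW.
pose c0 := \sum_(i < m.+1) alpha i * ff i 0 ^+ n.
(* In the first constant, [F 0] comes from the definition of [T_f] and [C] from positive parts. In
   the second, [A * C ^+ n] pays for negative values of the components, [c0] is [P o f] at the
   origin and [K] accounts for the roots. *)
exists (`|cartan_F ff 0| + C), (A * C ^+ n + `|c0| + K); split.
- exact: addr_ge0.
- by rewrite !addr_ge0// mulr_ge0// exprn_ge0.
move=> r r1 Tr; have r0 : 0 < r := lt_le_trans ltr01 r1.
have Cr0 : 0 <= C * r by rewrite mulr_ge0// ltW.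
have rn1 : 1 <= r ^+ n by exact: exprn_ege1.
have /andP[] := NP r r1.
set S := \sum_(1 <= j < n.+1) _.
rewrite (_ : \sum_(i < m.+1) alpha i * _ = \sum_(i < m.+1) alpha i * ff i r ^+ n
   + \sum_(i < m.+1) alpha i * ff i (- r) ^+ n - 2 * c0); last first.
  rewrite /c0 mulr_sumr -big_split -sumrB; apply: eq_bigr => i _ /=; by ring.
have /andP[] := fermat_sum_bounds Cr0 (fun i => (fC i r r1).1).
have /andP[] := fermat_sum_bounds Cr0 (fun i => (fC i r r1).2).
set fr := \sum_(i < m.+1) alpha i * ff i r ^+ n.
set fl := \sum_(i < m.+1) alpha i * ff i (- r) ^+ n.
set a := Num.max 0 (cartan_F ff r); set b := Num.max 0 (cartan_F ff (- r)).
have a0 : 0 <= a by rewrite le_max lexx.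
have b0 : 0 <= b by rewrite le_max lexx.
have Fa : cartan_F ff r <= a by rewrite le_max lexx orbT.
have Fb : cartan_F ff (- r) <= b by rewrite le_max lexx orbT.
(* [F] is at least [- (C * r)] at both points, so its positive part exceeds it by at most
   [C * r]. *)
have aF : a <= cartan_F ff r + C * r.
  have := (fC ord0 r r1).1; have := cartan_F_ge ord0 r.
  by rewrite /a ge_max => *; apply/andP; split; lra.
have bF : b <= cartan_F ff (- r) + C * r.
  have := (fC ord0 r r1).2; have := cartan_F_ge ord0 (- r).
  by rewrite /b ge_max => *; apply/andP; split; lra.
have F0r : `|cartan_F ff 0| <= `|cartan_F ff 0| * r by rewrite ler_peMr.
have F0 : `|cartan_F ff 0| >= cartan_F ff 0 by exact: ler_norm.
have F0N : `|cartan_F ff 0| >= - cartan_F ff 0 by rewrite -normrN ler_norm.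
have abT : cartan_T ff r - (`|cartan_F ff 0| + C) * r <= (a + b) / 2.
  by rewrite /cartan_T mulrDl; lra.
have Tab : (a + b) / 2 <= cartan_T ff r + (`|cartan_F ff 0| + C) * r.
  by rewrite /cartan_T mulrDl; lra.
have low : theta * (cartan_T ff r - (`|cartan_F ff 0| + C) * r) ^+ n
    <= theta * ((a ^+ n + b ^+ n) / 2).
  rewrite ler_pM2l ?bigmin_coef_gt0//; apply: le_trans (exprn_midpoint_le n a0 b0).
  by rewrite lerXn2r ?nnegrE//; lra.
(* The factor [2 ^+ n.-1] arises from [(a + b) ^+ n / 2 = 2 ^+ n.-1 * ((a + b) / 2) ^+ n]. *)
have up : A * ((a ^+ n + b ^+ n) / 2) <=
    2 ^+ n.-1 * A * (cartan_T ff r + (`|cartan_F ff 0| + C) * r) ^+ n.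
  rewrite [2 ^+ _ * A]mulrC -mulrA ler_wpM2l//.
  apply: (@le_trans _ _ (2 ^+ n.-1 * ((a + b) / 2) ^+ n)); last first.
    rewrite ler_pM2l ?exprn_gt0// lerXn2r ?nnegrE//; first by lra.
    by apply: le_trans Tab; lra.
  have -> : 2 ^+ n.-1 * ((a + b) / 2) ^+ n = (a + b) ^+ n / 2.
    have E : 2 ^+ n = 2 * 2 ^+ n.-1 :> R by rewrite -exprS prednK.
    by rewrite expr_div_n E; field; rewrite expf_neq0.
  by rewrite ler_pM2r ?invr_gt0// addX_le_exprD.
have c0r : `|c0| <= `|c0| * r ^+ n by rewrite ler_peMr.
have c01 : c0 <= `|c0| by exact: ler_norm.
have c02 : - c0 <= `|c0| by rewrite -normrN ler_norm.
have Kr : 0 <= K * r ^+ n by rewrite mulr_ge0// exprn_ge0// ltW.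
rewrite exprMn !mulrDl -/theta !mulrA in low up *.
by move=> *; apply/andP; split; lra.
Qed.

End CartanCharacteristic.

(** * Asymptotics as [r] tends to infinity *)

Lemma limf_esup_ratio_eq0 (R : realType) (T : R -> R) (d : R) :
  (forall r, 0 < r -> 0 <= T r) ->
  limf_esup (fun r : R => (r%:E / (T r)%:E)%E) (pinfty_nbhs R) = 0%E ->
  0 < d -> \forall r \near +oo, 0 < T r /\ r <= d * T r.
Proof.
move=> T0 lim0 d0.
have : (limf_esup (fun r : R => (r%:E / (T r)%:E)%E) (pinfty_nbhs R) < d%:E)%E.
  by rewrite lim0 lte_fin.
rewrite limf_esupE => /ereal_inf_lt[_ [V Vnear <-] supd].
have r_gt0 : \forall r \near +oo, (0 : R) < r by exact: nbhs_pinfty_gt.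
apply: filterS2 Vnear r_gt0 => r Vr r0.
have : (r%:E / (T r)%:E < d%:E)%E.
  by apply: le_lt_trans supd; apply: ereal_sup_ubound; exists r.
rewrite inver; have [_|Tr] := eqVneq (T r) 0.
  by rewrite gt0_muley ?lte_fin.
have Tr0 : 0 < T r by rewrite lt_neqAle eq_sym Tr T0.
by rewrite -EFinM lte_fin ltr_pdivrMr// => /ltW.
Qed.

(* The quotient r / T_f(r) is taken in the extended reals, where r / 0 = +oo for
   r > 0, so the limsup condition excludes T_f vanishing near infinity. *)
Theorem theorem5p8 (R : realType) (m : nat) (hm : (0 < m)%N)
    (f : R -> TP R m) (hf : trop_hol_curve f)
    (ff : 'I_m.+1 -> R -> R) (hff : reduced_representation f ff)
    (n : nat) (hn : (0 < n)%N)
    (alpha : 'I_m.+1 -> R) (halpha : forall i, 0 < alpha i)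
    (hlim : limf_esup (fun r : R => (r%:E / (cartan_T ff r)%:E)%E)
                      (pinfty_nbhs R) = 0%E) :
  let theta : R := \big[Num.min/alpha ord0]_(i < m.+1) alpha i in
  let Theta : R := 2 ^+ n.-1 * \sum_(i < m.+1) alpha i in
  exists2 e : R -> R,
    e =o_ (pinfty_nbhs R) (fun r : R => cartan_T ff r ^+ n) &
    (\forall r \near +oo,
      theta * cartan_T ff r ^+ n
      <= \sum_(1 <= j < n.+1)
           trop_N j r (fun x : R =>
             trop_div (trop_one R) (fermat_comp n alpha ff x)) + e r
      <= Theta * cartan_T ff r ^+ n).
Proof.
move=> theta Theta.
have : forall i, exists B,
    convex_pl (ff i) (derive_right 1 (ff i)) (derive_left 1 (ff i)) B.
  move=> i; have [[/(_ i)[ent|cst] _ _] _] := hff.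
    exact: trop_entire_convex_pl.
  by exists set0; exact: constant_convex_pl.
move=> /choice[B0 /convex_pl_bigcup cpl].
have T0 := cartan_T_ge0 cpl.
have [c [D [c0 D0 bounds]]] := sum_trop_N_cartan_bounds cpl halpha hn.
pose T := cartan_T ff.
pose S r := \sum_(1 <= j < n.+1) trop_N j r (fun x : R =>
              trop_div (trop_one R) (fermat_comp n alpha ff x)).
have theta0 : 0 < theta by exact: bigmin_coef_gt0.
(* Makes the target interval for the error term nonempty. *)
have thetaTheta : theta <= Theta.
  apply: (@le_trans _ _ (\sum_(i < m.+1) alpha i)).
    rewrite (bigD1 ord0)//= -[theta]addr0 lerD ?bigmin_le//.
    by rewrite sumr_ge0// => i _; rewrite ltW.
  rewrite /Theta ler_peMl ?exprn_ege1 ?ler1n//.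
  by rewrite sumr_ge0// => i _; rewrite ltW.
(* A single error term must serve both inequalities: take the point of the
   interval [[theta T^n - S, Theta T^n - S]] closest to [0]. *)
pose e r := Num.max (theta * T r ^+ n - S r) (Num.min 0 (Theta * T r ^+ n - S r)).
exists e; last first.
  have r_gt0 : \forall r \near +oo, (0 : R) < r by exact: nbhs_pinfty_gt.
  apply: filterS r_gt0 => r r0; rewrite -/(S r) -/(T r).
  have Tn : theta * T r ^+ n <= Theta * T r ^+ n.
    by rewrite ler_wpM2r// exprn_ge0// T0.
  rewrite -lerBlDl [e r]/e le_max lexx /= -lerBrDl ge_max lerD2r Tn.
  by rewrite ge_min lexx orbT.
apply/eqoP => eps eps0.
(* All errors are multiples of [r * T r ^+ n.-1]: the first summand covers the shifts of [T r] by
   [c * r] inside the powers, [D] covers [D * r ^+ n]. *)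
pose K := (theta + Theta) * (n%:R * 2 ^+ n.-1 * c) + D.
have K0 : 0 <= K.
  rewrite addr_ge0// !mulr_ge0// ?exprn_ge0// addr_ge0 ?ltW//.
  exact: lt_le_trans thetaTheta.
(* The first threshold gives [(1 + c) * r <= T r], the second [(1 + K) * r <= eps * T r]. *)
have d1 : 0 < (1 + c)^-1 by rewrite invr_gt0; lra.
have d2 : 0 < eps / (1 + K) by rewrite divr_gt0//; lra.
have near1 := limf_esup_ratio_eq0 T0 hlim d1.
have near2 := limf_esup_ratio_eq0 T0 hlim d2.
have r_ge1 : \forall r \near +oo, (1 : R) <= r by exact: nbhs_pinfty_ge.
apply: filterS3 r_ge1 near1 near2 => r r1 [Tr0 rT1] [_ rT2].
rewrite -/(T r) in Tr0 rT1 rT2 *.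
have r0 : 0 < r := lt_le_trans ltr01 r1.
have rT : (1 + c) * r <= T r.
  by move: rT1; rewrite mulrC ler_pdivlMr 1?mulrC//; lra.
have KrT : K * r <= eps * T r.
  have : (1 + K) * r <= eps * T r.
    by move: rT2; rewrite mulrAC ler_pdivlMr 1?mulrC//; lra.
  by lra.
have crT : c * r <= T r by lra.
have cr0 : 0 <= c * r by rewrite mulr_ge0// ltW.
have [low up] := andP (bounds r r1 crT).
have Tn0 k : 0 <= T r ^+ k by rewrite exprn_ge0// ltW.
have rTn : r ^+ n <= r * T r ^+ n.-1.
  rewrite -{1}(prednK hn) exprS ler_pM2l// lerXn2r// ?nnegrE; by lra.
have TE : T r ^+ n = T r * T r ^+ n.-1 by rewrite -exprS prednK.
have diff x : `|x| <= 2 * T r ->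
    `|x ^+ n - T r ^+ n| <= n%:R * 2 ^+ n.-1 * T r ^+ n.-1 * `|x - T r|.
  move=> xT; rewrite -[n%:R * _ * _]mulrA -exprMn; apply: ler_norm_subX => //.
  by rewrite gtr0_norm//; lra.
have diff1 : T r ^+ n - (T r - c * r) ^+ n <= n%:R * 2 ^+ n.-1 * c * (r * T r ^+ n.-1).
  have /diff : `|T r - c * r| <= 2 * T r by rewrite ger0_norm//; lra.
  have -> : T r - c * r - T r = - (c * r) by ring.
  rewrite normrN (ger0_norm cr0).
  by have := ler_norm (T r ^+ n - (T r - c * r) ^+ n); rewrite distrC; lra.
have diff2 : (T r + c * r) ^+ n - T r ^+ n <= n%:R * 2 ^+ n.-1 * c * (r * T r ^+ n.-1).
  have /diff : `|T r + c * r| <= 2 * T r by rewrite ger0_norm//; lra.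
  have -> : T r + c * r - T r = c * r by ring.
  rewrite (ger0_norm cr0).
  by have := ler_norm ((T r + c * r) ^+ n - T r ^+ n); lra.
pose P := r * T r ^+ n.-1; pose k := n%:R * 2 ^+ n.-1 * c.
have P0 : 0 <= P by rewrite mulr_ge0// ltW.
have k0 : 0 <= k by rewrite !mulr_ge0// exprn_ge0.
have KP : K * P <= eps * T r ^+ n.
  by rewrite TE !mulrA ler_wpM2r.
have KE : K * P = theta * (k * P) + Theta * (k * P) + D * P by rewrite /K /k; ring.
have kP0 : 0 <= k * P by exact: mulr_ge0.
have Theta0 : 0 < Theta by exact: lt_le_trans thetaTheta.
have DP : D * r ^+ n <= D * P by exact: ler_wpM2l.
have th1 := ler_wpM2l (ltW theta0) diff1; have th2 := ler_wpM2l (ltW Theta0) diff2.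
have th0 := mulr_ge0 (ltW theta0) kP0; have Th0 := mulr_ge0 (ltW Theta0) kP0.
have epsT := mulr_ge0 (ltW eps0) (Tn0 n).
rewrite -/k -/P in th1 th2; rewrite -/(S r) -/theta -/Theta -/(T r) in low up.
rewrite (ger0_norm (Tn0 n)) ler_norml /e le_max le_min ge_max ge_min.
(* It suffices that the left end of the interval is at most [eps * T r ^+ n], by [low], and the
   right end at least its opposite, by [up]. *)
apply/andP; split; [apply/orP; right|]; apply/andP; split.
- by lra.
- by lra.
- by lra.
- by apply/orP; left; lra.
Qed.
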